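(* Let $k\geq 2$ and $n\geq 3k+3$ be integers, and let $R=r(K_{1,k},K_n)=k(n-1)+1$. If $G$ is a graph with $G\longrightarrow(K_{1,k},K_n)$ and $|V(G)|=R+\ell$ where $0\leq \ell\leq \left\lfloor \frac{kn-2k^{2}}{(k+1)^{2}}\right\rfloor$, then $e(G)\geq \hat{r}^{*}(K_{1,k},K_n)$.
   Context: All graphs are finite and simple; $e(G)$ denotes the number of edges. $K_{1,k}$ is the star with $k$ edges and $K_n$ the complete graph on $n$ vertices. For graphs $F,G,H$, write $F\longrightarrow(G,H)$ if every red-blue colouring of the edges of $F$ yields a red copy of $G$ or a blue copy of $H$. The Ramsey number $r(G,H)$ is the least $N$ with $K_N\longrightarrow(G,H)$. The restricted size Ramsey number is $\hat{r}^{*}(G,H)=\min\{|E(F)| : F\longrightarrow(G,H),\ |V(F)|=r(G,H)\}$. *)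

(* Defs.v *)
From HB Require Import structures.
From mathcomp Require Import all_boot.
From mathcomp Require Import boolp.

Set Implicit Arguments.
Unset Strict Implicit.
Unset Printing Implicit Defensive.

(* A finite simple graph, given by its set of edges, i.e. of unordered pairs
   of distinct vertices. *)
Record sgraph := SGraph {
  vertex :> finType;
  edges : {set {set vertex}};
  card_edge : forall e, e \in edges -> #|e| = 2 }.

Definition nedges (G : sgraph) : nat := #|edges G|.

Lemma complete_subproof n (e : {set 'I_n}) :
  e \in [set e : {set 'I_n} | #|e| == 2] -> #|e| = 2.
Proof. by rewrite inE => /eqP. Qed.

Definition complete (n : nat) : sgraph := SGraph (@complete_subproof n).

Lemma star_subproof k (e : {set 'I_k.+1}) :
  e \in [set [set ord0; lift ord0 i] | i : 'I_k] -> #|e| = 2.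
Proof. by case/imsetP => i _ ->; rewrite cards2 neq_lift. Qed.

Definition star (k : nat) : sgraph := SGraph (@star_subproof k).

(* Copies are not required to be induced. *)
Definition has_copy (G F : sgraph) : Prop :=
  exists2 f : G -> F,
    injective f & forall e : {set G}, e \in edges G -> f @: e \in edges F.

Lemma color_class_subproof (F : sgraph) (c : {set F} -> bool) b e :
  e \in [set e in edges F | c e == b] -> #|e| = 2.
Proof. by rewrite inE => /andP[/card_edge]. Qed.

Definition color_class (F : sgraph) (c : {set F} -> bool) (b : bool) : sgraph :=
  SGraph (@color_class_subproof F c b).

(* F --> (G, H); [true] is red and [false] is blue, and the values of a
   colouring outside [edges F] are irrelevant. *)
Definition arrows (F G H : sgraph) : Prop :=
  forall c : {set F} -> bool,
    has_copy G (color_class c true) \/ has_copy H (color_class c false).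

Lemma ramsey_sets (a b : nat) : exists N : nat,
  forall (T : finType) (c : {set T} -> bool) (A : {set T}), N <= #|A| ->
    (exists2 S : {set T}, #|S| = a &
       {in S &, forall x y, x != y -> c [set x; y] = true}) \/
    (exists2 S : {set T}, #|S| = b &
       {in S &, forall x y, x != y -> c [set x; y] = false}).
Proof.
suff: exists N : nat,
  forall (T : finType) (c : {set T} -> bool) (A : {set T}), N <= #|A| ->
    (exists S : {set T}, [/\ S \subset A, #|S| = a &
       {in S &, forall x y, x != y -> c [set x; y] = true}]) \/
    (exists S : {set T}, [/\ S \subset A, #|S| = b &
       {in S &, forall x y, x != y -> c [set x; y] = false}]).
  case=> N HN; exists N => T c A /HN-/(_ c).
  by case=> [] [S [_ ? ?]]; [left | right]; exists S.
elim: a b => [|a IHa] b.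
  exists 0 => T c A _; left; exists set0.
  by rewrite sub0set cards0; split=> // x y; rewrite inE.
elim: b => [|b [N2 IHb]].
  exists 0 => T c A _; right; exists set0.
  by rewrite sub0set cards0; split=> // x y; rewrite inE.
have [N1 {}IHa] := IHa b.+1.
exists (N1 + N2).+1 => T c A leA.
have /card_gt0P[v vA] : 0 < #|A| by apply: leq_trans leA.
pose B d := [set x in A :\ v | c [set v; x] == d].
have Bsub d : B d \subset A.
  by apply/subsetP => x; rewrite !inE => /andP[/andP[]].
have addv d m (S : {set T}) : S \subset B d -> #|S| = m ->
    {in S &, forall x y, x != y -> c [set x; y] = d} ->
    [/\ v |: S \subset A, #|v |: S| = m.+1 &
       {in v |: S &, forall x y, x != y -> c [set x; y] = d}].
  move=> sSB <- hS; have vS : v \notin S.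
    by apply/negP => /(subsetP sSB); rewrite !inE eqxx.
  have cv x : x \in S -> c [set v; x] = d.
    by move/(subsetP sSB); rewrite !inE => /andP[_ /eqP].
  split; first by rewrite subUset sub1set vA (subset_trans sSB).
    by rewrite cardsU1 vS.
  move=> x y /setU1P[->|xS] /setU1P[->|yS] nxy; last exact: hS.
  - by rewrite eqxx in nxy.
  - exact: cv.
  - by rewrite setUC cv.
have [le1|lt1] := leqP N1 #|B true|.
  case: (IHa T c _ le1) => [] [S [sS cS hS]].
    by left; exists (v |: S); apply: addv.
  by right; exists S; split=> //; apply: subset_trans sS _.
have le2 : N2 <= #|B false|.
  have AE : A :\ v = B true :|: B false.
    by apply/setP => x; rewrite !inE; case: (c _); rewrite ?andbT ?andbF ?orbF.
  have := cardsD1 v A; rewrite vA AE => cA.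
  have := leq_card_setU (B true) (B false) => /= leU.
  rewrite -(leq_add2l N1); move: leA; rewrite cA ltnS => leA.
  have := leq_trans leA leU.1 => /leq_trans; apply.
  by rewrite leq_add2r ltnW.
case: (IHb T c _ le2) => [] [S [sS cS hS]].
  by left; exists S; split=> //; apply: subset_trans sS _.
by right; exists (v |: S); apply: addv.
Qed.

Lemma ramsey_exists (G H : sgraph) :
  exists N : nat, `[< arrows (complete N) G H >].
Proof.
have copy N (F : sgraph) (c : {set 'I_N} -> bool) b (S : {set 'I_N}) :
    #|S| = #|F| -> {in S &, forall x y, x != y -> c [set x; y] = b} ->
    has_copy F (@color_class (complete N) c b).
  move=> cS hS.
  pose f (x : F) : 'I_N := enum_val (cast_ord (esym cS) (enum_rank x)).
  have fI : injective f.
    by move=> x y /enum_val_inj/cast_ord_inj/enum_rank_inj.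
  exists f => // e /card_edge ce.
  have /eqP/cards2P[x [y [nxy ->]]] := ce.
  rewrite imsetU1 imset_set1 !inE cards2 (inj_eq fI) nxy /=.
  by apply/eqP/hS; rewrite ?enum_valP ?(inj_eq fI).
have [N HN] := ramsey_sets #|G| #|H|.
exists N; apply/asboolP => c.
case: (HN _ c setT); first by rewrite cardsT card_ord.
  by case=> S cS hS; left; apply: copy hS.
by case=> S cS hS; right; apply: copy hS.
Qed.

Definition ramsey (G H : sgraph) : nat := ex_minn (ramsey_exists G H).

(* F ranges over all graphs, so the set to be minimised is only a [Prop] and is
   made boolean by [asbool]. *)
Lemma restricted_size_ramsey_exists (G H : sgraph) :
  exists m : nat, `[< exists F : sgraph,
    [/\ arrows F G H, #|F| = ramsey G H & nedges F = m] >].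
Proof.
exists (nedges (complete (ramsey G H))); apply/asboolP.
exists (complete (ramsey G H)); split=> //; last by rewrite /= card_ord.
by rewrite /ramsey; case: ex_minnP => N /asboolP.
Qed.

Definition restricted_size_ramsey (G H : sgraph) : nat :=
  ex_minn (restricted_size_ramsey_exists G H).

(* Main.v *)
Require Import Defs.
From HB Require Import structures.
From mathcomp Require Import all_boot.
From mathcomp Require Import boolp zify.

Set Implicit Arguments.
Unset Strict Implicit.
Unset Printing Implicit Defensive.

(* A graph does not arrow (K_{1,k}, K_n) as soon as its vertices split into
   n - 1 parts inside which all degrees are < k: colour the edges inside the
   parts red.  With R + l vertices this works once there are l + 1 disjoint
   sets of k + 1 vertices in which the complement has no isolated vertex, the
   remaining vertices being cut into blocks of size k.

   Let c = k(k-1) for k odd and c = k(n-1) for k even.  A complement with more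
   than c/2 edges on at most R vertices contains one such set.  By induction on
   l, any complement with more than c/2 + C(R+l,2) - C(R,2) edges contains
   l + 1 disjoint ones: delete a vertex v of maximum degree and take l
   disjoint sets in the rest; either v has k neighbours outside them, giving a
   star, or all degrees are so small that, by the bound on l, more than c/2
   edges avoid these l sets.

   Conversely restricted_size_ramsey <= C(R,2) - c/2.  For k odd, K_R minus K_k
   arrows: red edges and the missing K_k together form a (k-1)-degenerate, hence
   k-colourable graph, and a colour class of size n is a blue K_n.  For k even,
   K_R minus a matching of size (R-1)/2 arrows: a partition into k/2 classes with
   the fewest red edges inside classes has a red matching in each class, and the
   union of two matchings is bipartite, so there is again a k-colouring. *)

(** * Adjacency; copies of stars and of cliques *)

Lemma imset_pair (T U : finType) (f : T -> U) x y :
  f @: [set x; y] = [set f x; f y].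
Proof. by rewrite imsetU1 imset_set1. Qed.

Definition adj (G : sgraph) : rel G := fun x y => [set x; y] \in edges G.

Lemma adj_sym (G : sgraph) : symmetric (adj (G := G)).
Proof. by move=> x y; rewrite /adj setUC. Qed.

Lemma adj_irr (G : sgraph) : irreflexive (adj (G := G)).
Proof.
move=> x; apply/negP => /card_edge.
by rewrite setUid cards1.
Qed.

Lemma adj_color (G : sgraph) (c : {set G} -> bool) b (x y : G) :
  @adj (color_class c b) x y = adj x y && (c [set x; y] == b).
Proof. by rewrite /adj inE. Qed.


Lemma has_star (G : sgraph) k (v : G) :
  k <= #|[set y | adj v y]| -> has_copy (star k) G.
Proof.
set N := [set y | _] => le_kN.
pose f (i : 'I_k.+1) : G := if unlift ord0 i is Some j
  then enum_val (widen_ord le_kN j) else v.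
have f0 : f ord0 = v by rewrite /f unlift_none.
have fS j : f (lift ord0 j) = enum_val (widen_ord le_kN j) by rewrite /f liftK.
have fN j : adj v (f (lift ord0 j)).
  by have := enum_valP (widen_ord le_kN j); rewrite fS inE.
exists f => [i j|e /imsetP[j _ ->]]; last first.
  by rewrite imset_pair f0; apply: fN.
case: (unliftP ord0 i) => [i'|] ->; case: (unliftP ord0 j) => [j'|] -> //.
- by rewrite !fS => /enum_val_inj/(congr1 val) /= /val_inj ->.
- by move=> E; have := fN i'; rewrite E f0 adj_irr.
- by move=> E; have := fN j'; rewrite -E f0 adj_irr.
Qed.

Lemma star_deg (G : sgraph) k :
  has_copy (star k) G -> exists v : G, k <= #|[set y | adj v y]|.
Proof.
case=> f fI fE; exists (f ord0).
rewrite -[k in k <= _]card_ord -(@card_imset _ _ (fun i : 'I_k => f (lift ord0 i))).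
  apply/subset_leq_card/subsetP => _ /imsetP[i _ ->]; rewrite inE /adj.
  by rewrite -imset_pair; apply: fE; apply/imsetP; exists i.
by move=> i j /fI /lift_inj.
Qed.

Lemma has_clique (G : sgraph) n (S : {set G}) : n <= #|S| ->
  {in S &, forall x y, x != y -> adj x y} -> has_copy (complete n) G.
Proof.
move=> le_nS cS.
pose f (i : 'I_n) : G := enum_val (widen_ord le_nS i).
have fI : injective f by move=> i j /enum_val_inj/(congr1 val) /= /val_inj.
exists f => // e; rewrite inE => /cards2P[x [y [nxy ->]]].
by rewrite imset_pair; apply: cS; rewrite ?enum_valP ?(inj_eq fI).
Qed.

Lemma clique_adj (G : sgraph) n : has_copy (complete n) G ->
  exists2 f : 'I_n -> G, injective f & forall i j, i != j -> adj (f i) (f j).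
Proof.
case=> f fI fE; exists f => // i j nij.
by rewrite /adj -imset_pair fE // inE cards2 nij.
Qed.

(** If no red star exists, red degrees are below k. By pigeonhole, a k-colouring proper for both the
    red edges and the non-edges has a class of n vertices, and all pairs in it are blue edges. *)
Lemma colorable_arrows (F : sgraph) k n (C : finType) :
  #|C| = k -> k * (n - 1) < #|F| -> 0 < n ->
  (forall red : rel F, symmetric red -> subrel red (@adj F) ->
     (forall x, #|[set y | red x y]| < k) ->
     exists f : F -> C, forall x y, x != y -> red x y || ~~ adj x y -> f x != f y) ->
  arrows F (star k) (complete n).
Proof.
move=> cC ltF n0 col c.
case: (pselect (exists v : F, k <= #|[set y | @adj (color_class c true) v y]|)).
  by case=> v /has_star; left.
move=> nstar; right.
have [|||f fP] := col (@adj (color_class c true)).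
- by move=> x y; exact: adj_sym.
- by move=> x y; rewrite adj_color => /andP[].
- by move=> x; rewrite ltnNge; apply/negP => ?; apply: nstar; exists x.
have [i le_i] : exists i, n <= #|f @^-1: [set i]|.
  case: (pickP (fun i => n <= #|f @^-1: [set i]|)) => [i ?|no]; first by exists i.
  suff : #|F| <= k * (n - 1) by lia.
  rewrite -cC -sum_nat_const -sum1_card (partition_big f predT) //=.
  apply: leq_sum => i _; have := no i; rewrite /= -sum1_card.
  under eq_bigl => x do rewrite !inE.
  lia.
have blue (x y : F) : f x = i -> f y = i -> x != y -> @adj (color_class c false) x y.
  move=> fx fy nxy; have := contraTF (fP x y nxy).
  rewrite fx fy eqxx !adj_color => /(_ isT).
  by case: (@adj F x y); case: (c [set x; y]).
apply: (@has_clique (color_class c false) n (f @^-1: [set i]) le_i) => x y.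
by rewrite !inE => /eqP fx /eqP fy; apply: blue.
Qed.

(** * Colourings from partitions into parts of small degree *)

(** The labels are natural numbers, so that disjoint covers can be glued by shifting one of them and
    [m = 0] is allowed for empty [W]. Labels outside [W] are irrelevant. *)
Definition coverable (G : sgraph) k (W : {set G}) m := exists phi : G -> nat,
  {in W, forall x, phi x < m /\
     #|[set y in W | (phi y == phi x) && adj x y]| < k}.

Lemma coverable_nonarrow (G : sgraph) k n m :
  m < n -> coverable k [set: G] m -> ~ arrows G (star k) (complete n).
Proof.
move=> mn [phi phiP] /(_ (fun e => [forall x in e, forall y in e, phi x == phi y])).
have cE x y : [forall u in [set x; y], forall w in [set x; y], phi u == phi w]
    = (phi x == phi y).
  apply/forall_inP/idP => [/(_ x)|E u].
    by rewrite set21 => /(_ isT)/forall_inP/(_ y); rewrite set22 => /(_ isT).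
  by rewrite !inE => /orP[]/eqP->; apply/forall_inP => w; rewrite !inE =>
    /orP[]/eqP->; rewrite // eq_sym.
case=> [/star_deg[v]|/clique_adj[f fI fE]].
  have [_ lt_k] := phiP v (in_setT v).
  rewrite leqNgt => /negP; apply; apply: leq_ltn_trans lt_k.
  apply/subset_leq_card/subsetP => y; rewrite !inE adj_color cE.
  by move=> /andP[-> /eqP E]; rewrite eq_sym E.
pose g i : 'I_m := Ordinal (phiP (f i) (in_setT _)).1.
suff /leq_card : injective g by rewrite !card_ord; lia.
move=> i j /(congr1 val) /= E; apply/eqP/negPn/negP => /fE.
by rewrite adj_color cE E eqxx andbF.
Qed.

Lemma coverableU (G : sgraph) k (A B : {set G}) a b : [disjoint A & B] ->
  coverable k A a -> coverable k B b -> coverable k (A :|: B) (a + b).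
Proof.
move=> dAB [f fP] [g gP].
have nA x : x \in B -> x \in A = false by move/(disjointFl dAB).
exists (fun x => if x \in A then f x else a + g x) => x.
rewrite inE; case: (boolP (x \in A)) => /= [xA _|xA xB].
  have [lt_a lt_k] := fP x xA; split; first by lia.
  apply: leq_ltn_trans lt_k; apply/subset_leq_card/subsetP => y.
  rewrite !inE; case: (y \in A) => //= /and3P[yB /eqP E _]; lia.
have [lt_a lt_k] := gP x xB; split; first by lia.
apply: leq_ltn_trans lt_k; apply/subset_leq_card/subsetP => y.
rewrite !inE; case: (boolP (y \in A)) => /= [yA /andP[/eqP E _]|_].
  by have [] := fP y yA; lia.
by rewrite eqn_add2l.
Qed.

Lemma coverable1 (G : sgraph) k (A : {set G}) :
  {in A, forall x, #|[set y in A | adj x y]| < k} -> coverable k A 1.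
Proof.
by move=> AP; exists (fun=> 0) => x /AP.
Qed.

Lemma coverable_blocks (G : sgraph) k m (A : {set G}) :
  #|A| <= k * m -> coverable k A m.
Proof.
elim: m A => [|m IH] A.
  rewrite muln0 leqn0 cards_eq0 => /eqP ->.
  by exists (fun=> 0) => x; rewrite inE.
move=> leA.
have [B [sBA cB]] : exists B : {set G}, B \subset A /\ #|B| = minn k #|A|.
  have /card_geqP[s [us ss sA]] : minn k #|A| <= #|A| by lia.
  exists [set x in s]; split; first by apply/subsetP => x; rewrite inE => /sA.
  by rewrite cardsE (card_uniqP us).
have cD : #|A :\: B| = #|A| - #|B| by rewrite cardsD (setIidPr sBA).
rewrite -(setID A B) (setIidPr sBA) -add1n; apply: coverableU.
- by rewrite disjoints_subset setCD subsetUr.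
- apply: coverable1 => x xB.
  suff : #|[set y in B | adj x y]| < #|B| by lia.
  apply/proper_card/properP; split; first by apply/subsetP => y; rewrite inE => /andP[].
  by exists x; rewrite // inE adj_irr andbF.
- by apply: IH; rewrite cD cB; nia.
Qed.

(** * Sets without isolated vertices *)

(* Ordered pairs, so an edge inside [A] counts twice in [npairs r A A]. *)
Definition npairs (T : finType) (r : rel T) (A B : {set T}) :=
  \sum_(x in A) #|[set y in B | r x y]|.

Lemma npairsE (T : finType) (r : rel T) (A B : {set T}) :
  npairs r A B = \sum_(x in A) \sum_(y in B) r x y.
Proof.
apply: eq_bigr => x _; rewrite -sum1_card big_mkcond [RHS]big_mkcond /=.
by apply: eq_bigr => y _; rewrite !inE; case: (y \in B); case: (r x y).
Qed.

Lemma npairsC (T : finType) (r : rel T) (A B : {set T}) :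
  symmetric r -> npairs r A B = npairs r B A.
Proof.
move=> rC; rewrite !npairsE exchange_big; apply: eq_bigr => x _.
by apply: eq_bigr => y _; rewrite rC.
Qed.

Lemma npairs_setD (T : finType) (r : rel T) (S W : {set T}) : symmetric r ->
  W \subset S ->
  npairs r S S <= npairs r (S :\: W) (S :\: W) + 2 * npairs r W S.
Proof.
move=> rC sWS.
have splitl (A B : {set T}) : npairs r S B = npairs r W B + npairs r (S :\: W) B.
  rewrite /npairs (big_setID W) (setIidPr sWS) //=.
have splitr : npairs r (S :\: W) S = npairs r W (S :\: W) + npairs r (S :\: W) (S :\: W).
  by rewrite npairsC // (splitl S).
have leW : npairs r W (S :\: W) <= npairs r W S.
  apply: leq_sum => x _; apply/subset_leq_card/subsetP => y.
  by rewrite !inE => /andP[/andP[_ ->] ->].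
rewrite (splitl S) splitr; lia.
Qed.

Definition no_isolated (T : finType) (r : rel T) (A : {set T}) :=
  {in A, forall x, exists2 y, y \in A & r x y}.

Lemma no_isolatedU (T : finType) (r : rel T) (A B : {set T}) :
  no_isolated r A -> {in B, forall x, exists2 y, y \in A :|: B & r x y} ->
  no_isolated r (A :|: B).
Proof.
move=> gA gB x; rewrite inE => /orP[/gA[y yA rxy]|/gB //].
by exists y; rewrite // inE yA.
Qed.

(** Growth goes by two vertices because parity can obstruct: if [r] is a perfect matching on [U],
    every subset without isolated vertices is even. *)
Lemma no_isolated_grow (T : finType) (r : rel T) (U A : {set T}) j :
  symmetric r -> irreflexive r -> no_isolated r U -> no_isolated r A ->
  A \subset U -> #|A| + 2 * j <= #|U| ->
  exists B : {set T}, [/\ B \subset U, #|B| = #|A| + 2 * j & no_isolated r B].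
Proof.
move=> rC rI gU; elim: j A => [|j IH] A gA sAU le_j.
  by exists A; rewrite muln0 addn0.
suff [B [sBU cB gB]] :
    exists B : {set T}, [/\ B \subset U, #|B| = #|A| + 2 & no_isolated r B].
  have [|B' [? cB' ?]] := IH B gB sBU; first by lia.
  by exists B'; split=> //; lia.
have cD : #|U :\: A| = #|U| - #|A| by rewrite cardsD (setIidPr sAU).
case: (boolP [exists u in U :\: A, exists w in U :\: A, r u w]).
  case/exists_inP => u uD /exists_inP[w wD ruw].
  have nuw : u != w by apply: contraTneq ruw => ->; rewrite rI.
  exists (A :|: [set u; w]); split.
  - rewrite !subUset !sub1set sAU.
    by move: uD wD; rewrite !inE => /andP[_ ->] /andP[_ ->].
  - rewrite cardsU cards2 nuw disjoint_setI0 ?cards0 ?subn0 //.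
    rewrite disjoint_sym disjoints_subset subUset !sub1set !inE.
    by move: uD wD; rewrite !inE => /andP[-> _] /andP[-> _].
  - apply: no_isolatedU => // x /set2P[]->.
      by exists w; rewrite // !inE eqxx !orbT.
    by exists u; rewrite 1?rC // !inE eqxx !orbT.
(* With no edge inside [U :\: A], every vertex there has a neighbour in [A], so any two of them may
   be added. *)
move=> /exists_inPn noD.
have /card_geqP[s [us ss sD]] : 2 <= #|U :\: A| by lia.
exists (A :|: [set x in s]); split.
- rewrite subUset sAU; apply/subsetP => x; rewrite inE => /sD.
  by rewrite inE => /andP[].
- rewrite cardsU disjoint_setI0 ?cards0 ?subn0.
    by rewrite cardsE (card_uniqP us) ss.
  rewrite disjoint_sym disjoints_subset; apply/subsetP => x; rewrite !inE => /sD.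
  by rewrite inE => /andP[].
- apply: no_isolatedU => // x; rewrite inE => /sD xD.
  have /gU[y yU rxy] : x \in U by move: xD; rewrite inE => /andP[].
  exists y => //; rewrite inE.
  have /exists_inPn/(_ y) := noD x xD; rewrite !inE yU andbT rxy.
  by case: (y \in A) => //= /(_ isT).
Qed.

Lemma npairs_le_sq (T : finType) (r : rel T) (S U : {set T}) :
  symmetric r -> irreflexive r -> U \subset S ->
  {in S, forall x y, y \in S -> r x y -> y \in U} ->
  npairs r S S <= #|U| * (#|U| - 1).
Proof.
move=> rC rI sUS UP.
rewrite -sum_nat_const [leqRHS]big_mkcond /npairs [leqLHS]big_mkcond /=.
apply: leq_sum => x _; case: ifP => // xS.
case: ifP => xU.
  have -> : #|U| - 1 = #|U :\ x| by have := cardsD1 x U; rewrite xU; lia.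
  apply/subset_leq_card/subsetP => y; rewrite !inE => /andP[yS rxy].
  by rewrite (UP x xS y yS rxy) andbT; apply: contraTneq rxy => ->; rewrite rI.
rewrite leqn0 cards_eq0; apply/eqP/setP => y; rewrite !inE.
apply/negP => /andP[yS rxy]; move: xU; rewrite (UP y yS x xS) //.
by rewrite rC.
Qed.

(** More than k vertices of S are non-isolated, since k vertices carry at most k(k-1) <= c ordered
    pairs. Among them a seed with the parity of k+1 is grown: the empty set for k odd, a vertex with
    two neighbours for k even. The latter exists because degrees at most 1 give only |S| <= c+1
    pairs. Pair counts are even, so for even c the bound [c.+2] just means more than c. *)
Lemma no_isolated_exists (T : finType) (r : rel T) (S : {set T}) k c :
  symmetric r -> irreflexive r -> 1 < k -> k * (k - 1) <= c ->
  (~~ odd k -> #|S| <= c.+1) -> c.+2 <= npairs r S S ->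
  exists A : {set T}, [/\ A \subset S, #|A| = k.+1 & no_isolated r A].
Proof.
move=> rC rI k1 le_c lt_S le_e.
pose U := [set x in S | [exists y in S, r x y]].
have UP x y : x \in S -> y \in S -> r x y -> x \in U.
  by move=> xS yS rxy; rewrite inE xS; apply/exists_inP; exists y.
have sUS : U \subset S by apply/subsetP => x; rewrite inE => /andP[].
have gU : no_isolated r U.
  move=> x; rewrite inE => /andP[xS /exists_inP[y yS rxy]]; exists y => //.
  by apply: (UP y x) => //; rewrite rC.
have le_U : k.+1 <= #|U|.
  have : npairs r S S <= #|U| * (#|U| - 1).
    apply: npairs_le_sq => // x xS y yS rxy.
    by apply: (UP y x) => //; rewrite rC.
  apply: contraTT; rewrite -!ltnNge ltnS => leU.
  have /leq_ltn_trans : #|U| * (#|U| - 1) <= k * (k - 1) by apply: leq_mul; lia.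
  by apply; lia.
suff [A [gA sAU leA oA]] : exists A : {set T},
    [/\ no_isolated r A, A \subset U, #|A| <= k.+1 & odd #|A| = ~~ odd k].
  have [|B [sBU cB gB]] := no_isolated_grow (j := (k.+1 - #|A|)./2) rC rI gU gA sAU.
    lia.
  by exists B; split=> //; [apply: subset_trans sUS|lia].
case: (boolP (odd k)) => [ok|/lt_S {}lt_S].
  by exists set0; rewrite cards0 sub0set; split=> // x; rewrite inE.
have [/exists_inP[x xS dx]|/exists_inPn no] :=
    boolP [exists x in S, 2 <= #|[set y in S | r x y]|]; last first.
  suff : npairs r S S <= #|S| by lia.
  rewrite -sum1_card; apply: leq_sum => x /no; lia.
have /card_geqP[s [us ss sN]] : 2 <= #|[set y in S | r x y]| by [].
have xs : x \notin s by apply/negP => /sN; rewrite inE rI andbF.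
have sP y : y \in s -> y \in S /\ r x y by move=> /sN; rewrite inE => /andP[].
exists (x |: [set y in s]); split.
- move=> y; rewrite !inE => /orP[/eqP->|ys]; last first.
    by exists x; [rewrite !inE eqxx|rewrite rC; case: (sP y ys)].
  case: s ss sP {us sN xs} => // z s _ /(_ z (mem_head _ _))[_ rxz].
  by exists z; rewrite // !inE eqxx orbT.
- rewrite subUset sub1set; apply/andP; split.
    case: s ss sP {us sN xs} => // y s _ /(_ y (mem_head _ _))[yS].
    exact: UP.
  apply/subsetP => y; rewrite inE => /sP[yS rxy].
  by apply: (UP y x) => //; rewrite rC.
- by rewrite cardsU1 cardsE (card_uniqP us) ss inE xs; lia.
- by rewrite cardsU1 cardsE (card_uniqP us) ss inE xs.
Qed.

(** * Colouring lemmas *)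

(** Greedy colouring in the order of ['I_N]: fewer than k earlier neighbours leave one of the k
    colours free. *)
Lemma degenerate_coloring N k (h : rel 'I_N) : symmetric h -> 0 < k ->
  (forall x : 'I_N, #|[set y : 'I_N | (y < x) && h x y]| < k) ->
  exists f : 'I_N -> 'I_k, forall x y, x != y -> h x y -> f x != f y.
Proof.
move=> hC k0 back.
suff /(_ N)[f fP] : forall m, exists f : 'I_N -> 'I_k,
    forall x y : 'I_N, x < m -> y < x -> h x y -> f x != f y.
  exists f => x y nxy hxy; case: (ltngtP x y) => [lt|lt|/val_inj/eqP].
  - by rewrite eq_sym fP // hC.
  - exact: fP.
  - by rewrite (negbTE nxy).
elim=> [|m [f fP]]; first by exists (fun=> Ordinal k0).
case: (ltnP m N) => [ltm|lem]; last first.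
  by exists f => x y _; apply: fP; apply: leq_trans lem.
pose z := Ordinal ltm.
have [i iP] : exists i, i \notin f @: [set y : 'I_N | (y < z) && h z y].
  apply/existsP; rewrite -negb_forall; apply/negP => /forallP full.
  have : #|'I_k| <= #|f @: [set y : 'I_N | (y < z) && h z y]|.
    by apply/subset_leq_card/subsetP => i _.
  by rewrite card_ord leqNgt (leq_ltn_trans (leq_imset_card _ _)).
exists (fun x => if x == z then i else f x) => x y ltx lty hxy.
have -> : (y == z) = false by apply/eqP => E; move: lty; rewrite E /=; lia.
case: (x =P z) => [E|nE]; last first.
  apply: fP => //; rewrite ltnS leq_eqVlt in ltx; case/orP: ltx => // /eqP E.
  by case: nE; apply: val_inj.
by apply: contraNneq iP => ->; apply: imset_f; rewrite inE -E lty.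
Qed.

Lemma involutions_2coloring (T : finType) (p q : T -> T) :
  involutive p -> involutive q -> (forall x, p x != x) -> (forall x, q x != x) ->
  exists f : T -> bool, forall x, f (p x) = ~~ f x /\ f (q x) = ~~ f x.
Proof.
(* [p] maps each orbit of [p \o q] to a different orbit: a coincidence
   (p \o q)^m x = p x would give, at the middle of the chain, a fixed point of
   [p] or [q]. *)
move=> pK qK pN qN.
pose t x := p (q x).
have tI : injective t by move=> x y E; apply: (can_inj qK); apply: (can_inj pK).
have tC := fconnect_sym tI.
have iterN m x : iter m t x != p x.
  elim/ltn_ind: m x => -[|[|m]] IH x; first by rewrite eq_sym.
    by rewrite /= (inj_eq (can_inj pK)).
  have := IH m (ltnW (leqnn _)) (t x); rewrite -iterSr.
  apply: contra_neq => E; apply: tI; rewrite -iterS E.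
  by rewrite {2}/t pK /t qK.
have npx x : ~~ fconnect t x (p x).
  by apply/negP => /iter_findex/eqP; rewrite (negbTE (iterN _ _)).
have npr x : froot t x != froot t (p x) by rewrite (root_connect tC).
have rq x : froot t (q x) = froot t (p x).
  by apply/eqP; rewrite (root_connect tC); apply/connect1; rewrite /= /t qK.
(* The orbits of [t] pair up: [p x] and [q x] share an orbit, different from that of [x]. Of two
   paired orbits, the one whose root has the smaller rank gets [true]. *)
exists (fun x => enum_rank (froot t x) < enum_rank (froot t (p x))) => x.
have nr : enum_rank (froot t x) != enum_rank (froot t (p x)) :> nat.
  by rewrite (inj_eq val_inj) (inj_eq enum_rank_inj).
have E : froot t (p (q x)) = froot t x.
  by apply/eqP; rewrite (root_connect tC) tC; apply/connect1/eqP.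
by rewrite rq E pK; split; lia.
Qed.

Lemma matchings_2coloring (T : finType) (r s : rel T) :
  symmetric r -> symmetric s -> irreflexive r -> irreflexive s ->
  (forall x, #|[set y | r x y]| <= 1) -> (forall x, #|[set y | s x y]| <= 1) ->
  exists f : T -> bool, forall x y, r x y || s x y -> f x != f y.
Proof.
move=> rC sC rI sI r1 s1.
(* Two copies of [T]: an unmatched vertex is sent to its own other copy, which
   makes the involutions fixed point free. *)
pose mate (e : rel T) x := [pick y | e x y].
pose p (e : rel T) (u : T * bool) : T * bool :=
  if mate e u.1 is Some y then (y, u.2) else (u.1, ~~ u.2).
have mateE (e : rel T) (e1 : forall x, #|[set y | e x y]| <= 1) x y :
    e x y -> mate e x = Some y.
  move=> exy; rewrite /mate; case: pickP => [z exz|/(_ y)]; last by rewrite exy.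
  by congr Some; apply: (card_le1_eqP (e1 x)); rewrite inE.
have pK (e : rel T) : symmetric e -> (forall x, #|[set y | e x y]| <= 1) ->
    involutive (p e).
  move=> eC e1 [x b]; rewrite /p /=.
  case E: (mate e x) => [y|]; last by rewrite /= E negbK.
  move: E; rewrite {1}/mate; case: pickP => // z exz [<-] /=.
  by rewrite (mateE e e1 z x) // eC.
have pN (e : rel T) : irreflexive e -> forall u, p e u != u.
  move=> eI [x b]; rewrite /p /= /mate; case: pickP => [y exy|_] /=.
    by apply: contraTneq exy => -[->]; rewrite eI.
  by rewrite xpair_eqE eqxx; case: b.
have [f fP] := involutions_2coloring (pK r rC r1) (pK s sC s1) (pN r rI) (pN s sI).
exists (fun x => f (x, false)) => x y; have [fr fs] := fP (x, false).
case/orP => [rxy|sxy].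
  by move: fr; rewrite /p /= (mateE r r1 x y) // => ->; case: (f _).
by move: fs; rewrite /p /= (mateE s s1 x y) // => ->; case: (f _).
Qed.

Lemma matching_partition (T : finType) (r : rel T) j :
  symmetric r -> irreflexive r -> (forall x, #|[set y | r x y]| < 2 * j) ->
  exists g : T -> 'I_j, forall x, #|[set y | r x y && (g x == g y)]| <= 1.
Proof.
move=> rC rI deg.
case: (posnP j) => [j0|j0].
  have T0 (x : T) : False by have := deg x; rewrite j0.
  by exists (fun x => False_rect _ (T0 x)) => x; case: (T0 x).
(* If [x] has two neighbours in its class, some class [i] contains at most one of
   its fewer than 2j neighbours, and moving [x] there decreases [mono]. *)
pose d (g : {ffun T -> 'I_j}) x i := \sum_(y | y != x) (r x y && (g y == i)).
have dE g x i : d g x i = #|[set y | r x y && (g y == i)]|.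
  rewrite -sum1_card /d big_mkcond [RHS]big_mkcond /=; apply: eq_bigr => y _.
  by rewrite inE; case: (eqVneq y x) => [->|_]; rewrite ?rI //=; case: (_ && _).
pose mono (g : {ffun T -> 'I_j}) := \sum_x \sum_y (r x y && (g y == g x) : nat).
case: (@arg_minnP _ [ffun=> Ordinal j0] xpredT mono) => // g _ gmin.
exists g => x; rewrite leqNgt; apply/negP => big.
have [i di] : exists i, d g x i <= 1.
  case: (pickP (fun i => d g x i <= 1)) => [i ?|no]; first by exists i.
  have := deg x; suff : 2 * j <= #|[set y | r x y]| by lia.
  rewrite -sum1_card (partition_big g predT) //= mulnC -[j in j * 2]card_ord -sum_nat_const.
  apply: leq_sum => i _; have := no i; rewrite /= dE -sum1_card.
  under eq_bigl => y do rewrite inE.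
  under [X in _ -> _ <= X]eq_bigl => y do rewrite inE.
  by move/negbT; rewrite -ltnNge.
pose g' := [ffun y => if y == x then i else g y].
have g'E y : y != x -> g' y = g y by rewrite ffunE => /negbTE ->.
have g'x : g' x = i by rewrite ffunE eqxx.
(* The second summand does not see the class of [x]. Since [d] skips [y = x] too, moving [x] only
   changes the class at which [d] is read. *)
have monoE (h : {ffun T -> 'I_j}) : mono h =
    2 * d h x (h x) + \sum_(u | u != x) \sum_(y | y != x) (r u y && (h y == h u)).
  rewrite /mono (bigD1 x) //= (bigD1 x) //= rI add0n.
  have -> : \sum_(u | u != x) \sum_y (r u y && (h y == h u) : nat) =
      d h x (h x) + \sum_(u | u != x) \sum_(y | y != x) (r u y && (h y == h u)).
    rewrite -big_split /=; apply: eq_bigr => u _; rewrite (bigD1 x) //=.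
    by rewrite rC [h x == _]eq_sym.
  by rewrite addnA addnn -mul2n.
have := gmin g' isT; rewrite !monoE g'x leqNgt => /negP; apply.
have -> : d g' x i = d g x i by apply: eq_bigr => y /g'E ->.
have -> : \sum_(u | u != x) \sum_(y | y != x) (r u y && (g' y == g' u)) =
    \sum_(u | u != x) \sum_(y | y != x) (r u y && (g y == g u)).
  by apply: eq_bigr => u /g'E ->; apply: eq_bigr => y /g'E ->.
rewrite ltn_add2r ltn_pmul2l // (leq_ltn_trans di) // dE.
by under eq_finset => y do rewrite eq_sym.
Qed.

(** * Packing *)

Definition nonadj (G : sgraph) : rel G := fun x y => (x != y) && ~~ adj x y.

Lemma nonadj_sym (G : sgraph) : symmetric (@nonadj G).
Proof. by move=> x y; rewrite /nonadj adj_sym eq_sym. Qed.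

Lemma nonadj_irr (G : sgraph) : irreflexive (@nonadj G).
Proof. by move=> x; rewrite /nonadj eqxx. Qed.

Lemma handshake (G : sgraph) : npairs (@adj G) setT setT = 2 * nedges G.
Proof.
transitivity (\sum_(e in edges G) #|e|); last first.
  rewrite (eq_bigr (fun=> 2)) => [|e /card_edge //].
  by rewrite sum_nat_const mulnC.
under [RHS]eq_bigr => e _ do rewrite -sum1_card.
rewrite (exchange_big_dep predT) //= /npairs.
apply: eq_big => [x|x _]; first by rewrite inE.
(* [y] to [[set x; y]] is a bijection from the neighbours of [x] to the edges containing [x]. *)
rewrite sum1dep_card -(@card_in_imset _ _ (fun y => [set x; y])).
  apply: eq_card => e; rewrite !inE; apply/imsetP/andP => [[y]|[eE xe]].
    by rewrite !inE => /= axy ->; rewrite set21.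
  have /eqP/cards2P[u [v [nuv E]]] := card_edge eE; subst e.
  case/set2P: xe => ->; first by exists v; rewrite ?inE.
  by exists u; rewrite ?inE 1?setUC //= /adj setUC.
move=> y z; rewrite !inE /= => axy axz E.
have : y \in [set x; z] by rewrite -E set22.
by case/set2P => [yx|//]; rewrite yx adj_irr in axy.
Qed.

Lemma npairs_nonadj (G : sgraph) :
  npairs (@nonadj G) setT setT + 2 * nedges G = #|G| * (#|G| - 1).
Proof.
rewrite -handshake /npairs -big_split /= -sum_nat_const.
apply: eq_big => [x|x _]; first by rewrite inE.
have -> : #|G| - 1 = #|[set~ x]| by rewrite cardsC1 subn1.
rewrite -(cardsID [set y | adj x y] [set~ x]) addnC; congr (_ + _).
  apply: eq_card => y; rewrite !inE /=.
  by case: eqVneq => //= ->; rewrite adj_irr.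
by apply: eq_card => y; rewrite !inE /nonadj /= andbC eq_sym.
Qed.

(** Among the k+1 vertices of [A], each one is adjacent neither to itself nor to some other vertex,
    which leaves at most k-1 neighbours. *)
Lemma coverable_no_isolated (G : sgraph) k (A : {set G}) :
  0 < k -> #|A| = k.+1 -> no_isolated (@nonadj G) A -> coverable k A 1.
Proof.
move=> k0 cA gA; apply: coverable1 => x xA.
have [y yA /andP[nxy naxy]] := gA x xA.
have -> : k = #|A :\ x|.-1.+1 by have := cardsD1 x A; rewrite xA; lia.
have := cardsD1 y (A :\ x); rewrite !inE eq_sym nxy yA add1n => ->.
rewrite ltnS /=; apply/subset_leq_card/subsetP => z; rewrite !inE.
move=> /andP[-> axz]; rewrite andbT; apply/andP; split.
  by apply: contraTneq axz => ->.
by apply: contraTneq axz => ->; rewrite adj_irr.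
Qed.

Lemma coverable_star (G : sgraph) k (S : {set G}) v :
  0 < k -> v \notin S -> {in S, forall y, nonadj v y} -> k <= #|S| ->
  exists A : {set G}, [/\ A \subset v |: S, #|A| = k.+1 & coverable k A 1].
Proof.
move=> k0 vS vP /card_geqP[s [us ss sS]].
have vs : v \notin s by apply: contra vS => /sS.
have cA : #|v |: [set y in s]| = k.+1.
  by rewrite cardsU1 cardsE (card_uniqP us) ss inE vs.
exists (v |: [set y in s]); split=> //.
  by apply: setUS; apply/subsetP => y; rewrite inE => /sS.
apply: coverable_no_isolated => // x; rewrite !inE => /orP[/eqP->|xs].
  case: s ss sS {us vs cA} => [|y s] ss sS; first by rewrite -ss in k0.
  by exists y; rewrite ?inE ?eqxx ?orbT //; apply/vP/sS; rewrite inE eqxx.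
by exists v; rewrite ?inE ?eqxx // nonadj_sym; apply/vP/sS.
Qed.

(** The first summand bounds the ordered pairs meeting (k+1)l vertices of degree at most (k+1)l+k-1.
    It equals 2l((k+1)^2 l+k^2-1) <= 2lR, while the right side exceeds R(R-1) by 2lR+l(l-1). *)
Lemma packing_arith k R l : 0 < k -> k.+1 ^ 2 * l + k ^ 2 <= R.+1 ->
  2 * (k.+1 * l * (k.+1 * l + k - 1)) + R * (R - 1) <= (R + l) * (R + l - 1).
Proof.
case: k => // k _ leR.
have leR' : k.+2 * (k.+2 * l + k) <= R by rewrite -mulnn in leR; nia.
rewrite addnS subSS subn0 -mulnA [X in 2 * X]mulnCA mulnA.
have : 2 * l * (k.+2 * (k.+2 * l + k)) <= 2 * l * R by rewrite leq_mul2l leR' orbT.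
by case: R {leR leR'} => [|R]; case: l => [|l]; nia.
Qed.

(** Adjacent and non-adjacent ordered pairs in S total (R+l)(R+l-1). So if [G] has e edges inside S,
    the last hypothesis says 2e+c+2 <= R(R-1), which does not involve l and survives the deletion of
    a vertex. *)
Lemma packing (G : sgraph) k R c l (S : {set G}) :
  1 < k ->
  (forall S' : {set G}, #|S'| <= R -> c.+2 <= npairs (@nonadj G) S' S' ->
     exists A : {set G}, [/\ A \subset S', #|A| = k.+1 & no_isolated (@nonadj G) A]) ->
  k.+1 ^ 2 * l + k ^ 2 <= R.+1 -> #|S| = R + l ->
  (R + l) * (R + l - 1) + c.+2 <= npairs (@nonadj G) S S + R * (R - 1) ->
  exists W : {set G}, [/\ W \subset S, #|W| = k.+1 * l.+1 & coverable k W l.+1].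
Proof.
set r := @nonadj G => k1 base.
have [rC rI] := (@nonadj_sym G : symmetric r, @nonadj_irr G : irreflexive r).
elim: l S => [|l IH] S leR cS le_e.
  have [|| A [sA cA gA]] := base S; [lia|lia|].
  exists A; split=> //; first by lia.
  by apply: coverable_no_isolated => //; lia.
have /card_gt0P[v0 v0S] : 0 < #|S| by lia.
have [v vS' vmax] := arg_maxnP (fun v => #|[set y in S | r v y]|) v0S.
have {vS'} vS : v \in S := vS'.
set D := #|_| in vmax.
have cSv : #|S :\ v| = R + l by have := cardsD1 v S; rewrite vS; lia.
have sv : [set v] \subset S by rewrite sub1set.
have leD : D <= #|S :\ v|.
  apply/subset_leq_card/subsetP => y; rewrite !inE => /andP[-> rvy].
  by rewrite andbT; apply: contraTneq rvy => ->; rewrite rI.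
have npv : npairs r [set v] S = D by rewrite /npairs big_set1.
have [|//||W [sW cW covW]] := IH (S :\ v).
- nia.
- have : (R + l.+1) * (R + l.+1 - 1) = (R + l) * (R + l - 1) + 2 * (R + l).
    by rewrite addnS subn1 /=; case: (R + l) => // N; rewrite subn1 /=; lia.
  have := npairs_setD rC sv; rewrite npv; lia.
have sWS : W \subset S by apply: subset_trans sW (subsetDl _ _).
suff [A [sA cA covA]] :
    exists A : {set G}, [/\ A \subset S :\: W, #|A| = k.+1 & coverable k A 1].
  have dWA : [disjoint W & A].
    by rewrite disjoint_sym; move: sA; rewrite subsetD => /andP[].
  exists (W :|: A); split.
  - by rewrite subUset sWS (subset_trans sA) ?subsetDl.
  - by rewrite cardsU disjoint_setI0 // cards0 cW cA; lia.
  - by rewrite -addn1; apply: coverableU.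
have vW : v \notin W by apply/negP => /(subsetP sW); rewrite !inE eqxx.
(* [W] has (k+1)(l+1) vertices. From this threshold on, [v] keeps k non-neighbours outside [W];
   below it, every degree in the complement is at most (k+1)(l+1)+k-1. *)
case: (leqP (k.+1 * l.+1 + k) D) => [bigD|smallD].
  have [||||A [sA cA covA]] := @coverable_star G k ([set y in S | r v y] :\: W) v.
  - lia.
  - by rewrite !inE rI !andbF.
  - by move=> y; rewrite !inE => /and3P[].
  - rewrite cardsD; have : #|[set y in S | r v y] :&: W| <= #|W|.
      by apply/subset_leq_card/subsetIr.
    by move: bigD; rewrite /D; lia.
  exists A; split=> //; apply: subset_trans sA _.
  rewrite subUset sub1set !inE vS vW /=; apply: setSD.
  by apply/subsetP => y; rewrite inE => /andP[].
have npW : npairs r W S <= k.+1 * l.+1 * (k.+1 * l.+1 + k - 1).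
  rewrite -cW -sum_nat_const; apply: leq_sum => x /(subsetP sWS)/vmax; lia.
(* [S :\: W] has at most R vertices, as |W| >= l+1, and by [packing_arith] it keeps at least c+2
   non-adjacent pairs. *)
have [||A [sA cA gA]] := base (S :\: W).
- by rewrite cardsD (setIidPr sWS) cS cW mulSn; lia.
- have := npairs_setD rC sWS.
  have := packing_arith (ltnW k1) leR.
  lia.
- by exists A; split=> //; apply: coverable_no_isolated => //; lia.
Qed.

(** * Upper bound on the restricted size Ramsey number *)

Lemma rel_sgraph_subproof (T : finType) (a : rel T) (e : {set T}) :
  e \in [set e : {set T} | [exists x, exists y, [&& x != y, a x y & e == [set x; y]]]] ->
  #|e| = 2.
Proof.
rewrite inE => /existsP[x /existsP[y /and3P[nxy _ /eqP->]]].
by rewrite cards2 nxy.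
Qed.

Definition rel_sgraph (T : finType) (a : rel T) : sgraph :=
  SGraph (@rel_sgraph_subproof T a).

Lemma adj_rel_sgraph (T : finType) (a : rel T) (x y : T) : symmetric a ->
  @adj (rel_sgraph a) x y = (x != y) && a x y.
Proof.
move=> aC; rewrite /adj inE; apply/existsP/andP => [[u /existsP[v]]|[nxy axy]].
  case/and3P=> nuv auv /eqP E.
  have : u \in [set x; y] by rewrite E set21.
  have : v \in [set x; y] by rewrite E set22.
  move=> /set2P[]Ev /set2P[]Eu; subst u v; rewrite ?eqxx // in nuv *.
  by rewrite eq_sym nuv aC.
by exists x; apply/existsP; exists y; rewrite nxy axy eqxx.
Qed.

Lemma adj_complete n (x y : 'I_n) : @adj (complete n) x y = (x != y).
Proof. by rewrite /adj inE cards2; case: (x != y). Qed.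

Lemma card_ltn_ord N m : m <= N -> #|[set x : 'I_N | x < m]| = m.
Proof.
move=> le_m; rewrite -[RHS]card_ord.
rewrite -(@card_imset _ _ (widen_ord le_m)); last by move=> x y /(congr1 val) /= /val_inj.
apply: eq_card => x; rewrite inE; apply/idP/imsetP => [lt|[y _ ->]]; last exact: (ltn_ord y).
by exists (Ordinal lt) => //; apply: val_inj.
Qed.

(** The clique is placed first in the order of ['I_N]: its vertices have fewer than k predecessors
    at all, and any later vertex has only red neighbours before it. Greedy colouring then
    applies. *)
Lemma clique_union_coloring N k (red : rel 'I_N) : 0 < k -> symmetric red ->
  (forall x, #|[set y | red x y]| < k) ->
  exists f : 'I_N -> 'I_k, forall x y : 'I_N,
    x != y -> red x y || (x < k) && (y < k) -> f x != f y.
Proof.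
move=> k0 redC deg.
apply: (degenerate_coloring (h := fun x y => red x y || (x < k) && (y < k))) => //.
  by move=> x y; rewrite redC andbC.
move=> x; case: (ltnP x k) => [ltxk|lekx].
  apply: leq_ltn_trans ltxk; rewrite -[X in _ <= X](card_ltn_ord (ltnW (ltn_ord x))).
  by apply/subset_leq_card/subsetP => y; rewrite !inE => /andP[].
apply: leq_ltn_trans (deg x).
by apply/subset_leq_card/subsetP => y; rewrite !inE orbF => /andP[].
Qed.

(** The red edges inside the classes of a [matching_partition] form a matching, so one bit separates
    the ends of these and of all edges of [m]. The class separates the ends of the other red
    edges. *)
Lemma matching_union_coloring (T : finType) j (red m : rel T) :
  symmetric red -> irreflexive red -> symmetric m -> irreflexive m ->
  (forall x, #|[set y | red x y]| < 2 * j) -> (forall x, #|[set y | m x y]| <= 1) ->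
  exists f : T -> 'I_j * bool, forall x y, red x y || m x y -> f x != f y.
Proof.
move=> redC redI mC mI deg m1.
have [g gP] := matching_partition redC redI deg.
have [||b bP] := @matchings_2coloring _ (fun x y => red x y && (g x == g y)) m _ mC _ mI gP m1.
- by move=> x y; rewrite redC eq_sym.
- by move=> x; rewrite redI.
exists (fun x => (g x, b x)) => x y rm; rewrite xpair_eqE negb_and.
by case: eqP => //= /eqP E; apply: bP; rewrite E andbT.
Qed.

(** The witness is K_R minus the edges of [m]. The colouring must split these as well, because a
    blue clique cannot contain a missing edge. Counting ordered pairs avoids halves. *)
Lemma restricted_size_ramsey_le k n (C : finType) (m : rel 'I_(k * (n - 1) + 1)) :
  let R := k * (n - 1) + 1 in
  ramsey (star k) (complete n) = R -> #|C| = k -> 0 < n ->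
  symmetric m -> irreflexive m ->
  (forall red : rel 'I_R, symmetric red -> irreflexive red ->
     (forall x, #|[set y | red x y]| < k) ->
     exists f : 'I_R -> C, forall x y, x != y -> red x y || m x y -> f x != f y) ->
  2 * restricted_size_ramsey (star k) (complete n) + npairs m setT setT <=
    R * (k * (n - 1)).
Proof.
move=> R ER cC n0 mC mI col.
pose F := rel_sgraph (fun x y => ~~ m x y).
have adjF x y : @adj F x y = (x != y) && ~~ m x y.
  by apply: adj_rel_sgraph => u v; rewrite mC.
have cF : #|F| = R by rewrite /= card_ord.
have arrF : arrows F (star k) (complete n).
  apply: (colorable_arrows cC) => //; first by rewrite cF /R; lia.
  move=> red redC redF deg.
  have redI : irreflexive red.
    by move=> x; apply/negP => /redF; rewrite adj_irr.
  have [f fP] := col red redC redI deg.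
  exists f => x y nxy; rewrite adjF nxy negbK; exact: fP.
have le_F : restricted_size_ramsey (star k) (complete n) <= nedges F.
  rewrite /restricted_size_ramsey; case: ex_minnP => N _; apply.
  by apply/asboolP; exists F; rewrite ER.
have := npairs_nonadj F; rewrite cF addnK.
have -> : npairs (@nonadj F) setT setT = npairs m setT setT.
  apply: eq_bigr => x _; apply: eq_card => y; rewrite !inE /nonadj adjF /=.
  by case: eqVneq => [->|]; rewrite ?mI ?negbK.
lia.
Qed.

(** Upper bound: red degrees below k allow k colours. Lower bound: at most k(n-1) vertices are cut
    into n-1 blocks of at most k vertices. *)
Lemma ramsey_star_complete k n : 0 < k -> 0 < n ->
  ramsey (star k) (complete n) = k * (n - 1) + 1.
Proof.
move=> k0 n0; rewrite /ramsey; case: ex_minnP => N /asboolP arrN minN.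
apply/eqP; rewrite eqn_leq; apply/andP; split.
  apply: minN; apply/asboolP; apply: (@colorable_arrows _ _ _ 'I_k) => //.
  - by rewrite card_ord.
  - by rewrite /= card_ord; lia.
  move=> red redC _ deg; have [f fP] := clique_union_coloring k0 redC deg.
  by exists f => x y nxy; rewrite adj_complete nxy orbF => rxy; apply: fP; rewrite ?rxy.
rewrite addn1 ltnNge; apply/negP => leN; apply: (@coverable_nonarrow _ k n (n - 1)) arrN.
  by lia.
by apply: coverable_blocks; rewrite cardsT /= card_ord.
Qed.

Lemma restricted_size_ramsey_odd k n : 0 < k -> 1 < n ->
  2 * restricted_size_ramsey (star k) (complete n) + k * (k - 1) <=
  (k * (n - 1) + 1) * (k * (n - 1)).
Proof.
set R := _ + 1 => k0 n1; have leR : k <= R by rewrite /R; nia.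
pose m : rel 'I_R := fun x y => [&& x != y, x < k & y < k].
apply: leq_trans (restricted_size_ramsey_le (C := 'I_k) (m := m) _ _ _ _ _ _).
- rewrite leq_add2l -[X in X * _](card_ltn_ord leR) -sum_nat_const /npairs.
  rewrite big_mkcond [leqRHS]big_mkcond /=; apply: leq_sum => x _; rewrite !inE.
  case: ifP => // ltx.
  have -> : k - 1 = #|[set y : 'I_R | y < k] :\ x|.
    by have := cardsD1 x [set y : 'I_R | y < k]; rewrite inE ltx (card_ltn_ord leR); lia.
  by apply/subset_leq_card/subsetP => y; rewrite !inE /m ltx eq_sym.
- by apply: ramsey_star_complete; lia.
- exact: card_ord.
- by lia.
- by move=> x y; rewrite /m eq_sym [(x < k) && _]andbC.
- by move=> x; rewrite /m eqxx.
- move=> red redC redI deg; have [f fP] := clique_union_coloring k0 redC deg.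
  by exists f => x y nxy; rewrite /m nxy; apply: fP.
Qed.

Lemma restricted_size_ramsey_even k n : 0 < k -> ~~ odd k -> 0 < n ->
  2 * restricted_size_ramsey (star k) (complete n) + k * (n - 1) <=
  (k * (n - 1) + 1) * (k * (n - 1)).
Proof.
set R := _ + 1 => k0 ek n0.
(* Vertices 2i and 2i+1 are matched; R is odd for k even, so only the last vertex stays
   unmatched. *)
pose m : rel 'I_R := fun x y => (x != y) && (x./2 == y./2).
have mC : symmetric m by move=> x y; rewrite /m eq_sym [_./2 == _]eq_sym.
have mI : irreflexive m by move=> x; rewrite /m eqxx.
have kE : k = 2 * k./2 by lia.
apply: leq_trans (restricted_size_ramsey_le (C := ('I_(k./2) * bool)%type) (m := m) _ _ _ _ _ _) => //.
- have leR : k * (n - 1) <= R by rewrite /R; lia.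
  rewrite leq_add2l -[X in X <= _](card_ltn_ord leR) -sum1_card /npairs.
  rewrite big_mkcond [leqRHS]big_mkcond /=; apply: leq_sum => x _; rewrite !inE.
  case: ifP => // ltx; apply/card_gt0P.
  have lty : (if odd x then x.-1 else x.+1) < R.
    have step N : ~~ odd N -> x < N -> (if odd x then x.-1 else x.+1) < N + 1.
      by case: ifP; lia.
    by apply: step; rewrite // oddM (negbTE ek).
  exists (Ordinal lty); rewrite !inE /m -val_eqE /=.
  by case: ifP => ox; apply/andP; split; lia.
- by apply: ramsey_star_complete.
- by rewrite card_prod card_ord card_bool; lia.
- move=> red redC redI deg.
  have [||f fP] := @matching_union_coloring _ k./2 red m redC redI mC mI.
  - by rewrite -kE.
  - move=> x; apply/card_le1_eqP => y z; rewrite !inE /m -!val_eqE /=.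
    have half_inj (a b c : nat) :
        a != b -> a./2 = b./2 -> a != c -> a./2 = c./2 -> b = c by lia.
    move=> /andP[nxy /eqP Exy] /andP[nxz /eqP Exz].
    by apply/val_inj/(half_inj x).
  by exists f => x y _; apply: fP.
Qed.

(** * Graphs on R + l vertices with too few edges *)

(* Both subtractions below are exact, as n >= 3k + 3. *)
Theorem theorem5 (k n : nat) (hk : 2 <= k) (hn : 3 * k + 3 <= n) :
  let R := ramsey (star k) (complete n) in
  R = k * (n - 1) + 1 /\
  forall (G : sgraph) (l : nat),
    arrows G (star k) (complete n) ->
    #|G| = R + l ->
    0 <= l <= (k * n - 2 * k ^ 2) %/ (k + 1) ^ 2 ->
    restricted_size_ramsey (star k) (complete n) <= nedges G.
Proof.
move=> R; have ER : R = k * (n - 1) + 1 by apply: ramsey_star_complete; lia.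
split=> // G l arrG cG; rewrite leq0n leq_divRL ?expn_gt0 ?addn1 //= => le_l.
rewrite leqNgt; apply/negP => lt_e.
(* Twice the number of edges left out of K_R in the upper bound, and also the threshold for
   [no_isolated_exists]. For k even it is R-1, so sets of at most R vertices satisfy |S| <= c+1. *)
pose c := if odd k then k * (k - 1) else k * (n - 1).
have le_c : 2 * restricted_size_ramsey (star k) (complete n) + c <= R * (R - 1).
  rewrite /c ER addnK; case: ifP => [_|/negbT ek].
    by apply: restricted_size_ramsey_odd; lia.
  by apply: restricted_size_ramsey_even; lia.
have [//|S leS le_e||||W [_ cW covW]] := @packing G k R c l setT.
- apply: no_isolated_exists le_e => //.
  + exact: nonadj_sym.
  + exact: nonadj_irr.
  + by rewrite /c; case: ifP => _ //; apply: leq_mul => //; lia.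
  + by rewrite /c => /negbTE ->; rewrite -addn1 -ER.
(* The bound on l gives (k+1)^2 l+k^2 <= kn-k^2, which is at most R+1 = kn-k+2. *)
- by rewrite ER; nia.
- by rewrite cardsT.
(* One edge fewer than the restricted size Ramsey number means 2 ordered pairs fewer, whence the 2
   in [c.+2]. *)
- have := npairs_nonadj G; rewrite cG; lia.
have cC := cardsCs W.
have leW : k * l.+1 <= k * (n - 1).
  by have := max_card (mem W); rewrite cW cG ER; lia.
have le_ln : l.+1 <= n - 1 by rewrite leq_pmul2l // in leW; lia.
(* Outside [W] there are R+l-(k+1)(l+1) = k(n-1-(l+1)) vertices. They fill n-1-(l+1) blocks of size
   k, which makes n-1 parts in all. *)
apply: (@coverable_nonarrow G k n (l.+1 + (n - 1 - l.+1))) arrG; first by lia.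
rewrite -(setUCr W); apply: coverableU => //.
  by rewrite disjoints_subset setCK.
by apply: coverable_blocks; rewrite mulnBr cardsCs setCK cW cG ER; lia.
Qed.
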